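(* Consider the two-stage robust facility location problem (2-stage RO-FLP) and the two-stage robust bilevel facility location problem (2-stage RBO-FLP) built from the same data $(N,F,f,c,K,\rho,d,\Gamma)$, with optimal values $W_{\{RO\}}$ and $W_{\{RBO\}}$. Then: (a) Any solution feasible to 2-stage RO-FLP is feasible to 2-stage RBO-FLP. (b) 2-stage RO-FLP is a relaxation of 2-stage RBO-FLP and yields a lower bound for it, i.e. $W_{\{RO\}}\le W_{\{RBO\}}$.
   Context: Data: finite nonempty sets $N$ (customers) and $F$ (facilities); real numbers, all nonnegative: fixed cost $f_j$ and capacity $K_j$ for $j\in F$; demand $d_i$ and unit unmet-demand penalty $\rho_i$ for $i\in N$; unit allocation cost $c_{ij}$ for $i\in N,j\in F$; and a nonnegative integer $\Gamma$. Uncertainty set: $\mathcal U=\{s\in\{0,1\}^{F}:\sum_{j\in F}s_j\le\Gamma\}$ ($s_j=1$ means facility $j$ is disrupted). For $y\in\{0,1\}^F$ and $s\in\mathcal U$, let $X(y,s)$ be the set of $(x,u)\in\mathbb R^{N\times F}\times\mathbb R^{N}$ with $x\ge0$, $u\ge0$, $\sum_{i\in N}x_{ij}\le K_jy_j(1-s_j)$ for all $j\in F$, and $\sum_{j\in F}x_{ij}+u_i=d_i$ for all $i\in N$. Let $\phi(y,s)=\operatorname{argmin}\{\sum_{i\in N}u_i:(x,u)\in X(y,s)\}\subseteq X(y,s)$ be the optimal solution set of the lower-level problem. 2-stage RBO-FLP: $W_{\{RBO\}}=\min_{y\in\{0,1\}^{F}}\Big(\sum_{j}f_jy_j+\max_{s\in\mathcal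 U}\min_{(x,u)\in\phi(y,s)}\big(\sum_{i}\sum_{j}c_{ij}x_{ij}+\sum_{i}\rho_iu_i\big)\Big)$. 2-stage RO-FLP: $W_{\{RO\}}$ is given by the same formula with $\phi(y,s)$ replaced by $X(y,s)$. A solution here is a first-stage decision $y\in\{0,1\}^F$. It is feasible to 2-stage RO-FLP if $X(y,s)\neq\emptyset$ for every $s\in\mathcal U$, and feasible to 2-stage RBO-FLP if $\phi(y,s)\neq\emptyset$ for every $s\in\mathcal U$. That RO-FLP is a relaxation of RBO-FLP means that both have the same first-stage set and the same uncertainty set, and $\phi(y,s)\subseteq X(y,s)$ for all $y,s$. *)

(* Defs.v *)
From HB Require Import structures.
From mathcomp Require Import all_boot all_order all_algebra.
From mathcomp Require Import all_classical all_reals ereal.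
Set Implicit Arguments.
Unset Strict Implicit.
Unset Printing Implicit Defensive.
Import Order.TTheory GRing.Theory Num.Theory.
Local Open Scope classical_set_scope.
Local Open Scope ring_scope.

Record flp_data (R : realType) (N F : finType) := FLPData {
  fixed_cost : F -> R;
  capacity : F -> R;
  demand : N -> R;
  penalty : N -> R;
  alloc_cost : N -> F -> R;
  budget : nat }.

(* A 0-1 vector indexed by F; it enters real formulas through (v j)%:R. *)
Definition binvec (F : finType) := {ffun F -> bool}.

(* A second-stage decision (x, u). *)
Definition plan (R : realType) (N F : finType) : Type :=
  ((N -> F -> R) * (N -> R))%type.

(* What distinguishes one two-stage program from another over the same data. *)
Record two_stage (R : realType) (N F : finType) := TwoStage {
  first_stage : {set binvec F};
  uncertainty : {set binvec F};
  recourse : binvec F -> binvec F -> set (plan R N F) }.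

Definition argmin (R : realType) (T : Type) (A : set T) (g : T -> R) : set T :=
  [set z | A z /\ forall z', A z' -> g z <= g z'].

Section FLP.
Variables (R : realType) (N F : finType) (D : flp_data R N F).

Definition disruptions : {set binvec F} :=
  [set s : binvec F | (\sum_(j : F) s j <= budget D)%N].

Definition X (y s : binvec F) : set (plan R N F) :=
  [set xu | [/\ forall i j, 0 <= xu.1 i j,
                forall i, 0 <= xu.2 i,
                forall j, \sum_(i : N) xu.1 i j
                            <= capacity D j * (y j)%:R * (1 - (s j)%:R)
              & forall i, \sum_(j : F) xu.1 i j + xu.2 i = demand D i]].

Definition unmet (xu : plan R N F) : R := \sum_(i : N) xu.2 i.

Definition phi (y s : binvec F) : set (plan R N F) := argmin (X y s) unmet.

Definition recourse_cost (xu : plan R N F) : R :=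
  \sum_(i : N) \sum_(j : F) alloc_cost D i j * xu.1 i j
  + \sum_(i : N) penalty D i * xu.2 i.

Definition RO_FLP : two_stage R N F := TwoStage [set: binvec F] disruptions X.
Definition RBO_FLP : two_stage R N F := TwoStage [set: binvec F] disruptions phi.

(* The minimum over the recourse set is taken as an infimum in the extended
   reals, with value +oo on the empty set. *)
Definition opt_value (P : two_stage R N F) : \bar R :=
  \big[Order.min/+oo%E]_(y in first_stage P)
    ((\sum_(j : F) fixed_cost D j * (y j)%:R)%:E +
     \big[Order.max/-oo%E]_(s in uncertainty P)
       ereal_inf [set (recourse_cost xu)%:E | xu in recourse P y s])%E.

End FLP.

Definition feasible (R : realType) (N F : finType) (P : two_stage R N F)
    (y : binvec F) : Prop :=
  y \in first_stage P /\
  forall s, s \in uncertainty P -> recourse P y s !=set0.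

Definition relaxation_of (R : realType) (N F : finType)
    (P Q : two_stage R N F) : Prop :=
  [/\ first_stage P = first_stage Q,
      uncertainty P = uncertainty Q
    & forall y s, y \in first_stage Q -> s \in uncertainty Q ->
        recourse Q y s `<=` recourse P y s].

(* Main.v *)
(** The proportional allocation x_ij = d_i k_j / max (sum d, sum k) respects
    both the demands d and the effective capacities k, and leaves unmet exactly
    max (0, sum d - sum k), which no plan can beat. Hence the lower level
    always attains its minimum, so phi(y,s) is never empty; the rest is
    monotonicity of inf, max and min along phi(y,s) `<=` X(y,s). *)
Require Import Defs.
From HB Require Import structures.
From mathcomp Require Import all_boot all_order all_algebra.
From mathcomp Require Import all_classical all_reals ereal.
Set Implicit Arguments.
Unset Strict Implicit.
Unset Printing Implicit Defensive.
Import Order.TTheory GRing.Theory Num.Theory.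
Local Open Scope ring_scope.

Section Allocation.
Variables (R : realType) (N F : finType) (D : flp_data R N F).
Variables (y s : binvec F).

Definition effective_capacity (j : F) : R :=
  capacity D j * (y j)%:R * (1 - (s j)%:R).

Let k := effective_capacity.
Let total_demand : R := \sum_i demand D i.
Let total_capacity : R := \sum_j k j.

Definition proportional_alloc (i : N) (j : F) : R :=
  demand D i * k j / Num.max total_demand total_capacity.

Definition proportional_plan : plan R N F :=
  (proportional_alloc,
   fun i => demand D i - \sum_j proportional_alloc i j).

Lemma unmet_ge0 xu : X D y s xu -> 0 <= unmet xu.
Proof. by case=> _ u_ge0 _ _; apply: sumr_ge0. Qed.

(** Summing the demand equations over the customers makes total demand equal to total allocation
    plus unmet demand; summed by columns, the allocation is at most the total effective capacity. *)
Lemma unmet_ge_shortage xu :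
  X D y s xu -> total_demand - total_capacity <= unmet xu.
Proof.
case=> _ _ capx demx; rewrite lerBlDr /total_demand.
under eq_bigr do rewrite -demx.
by rewrite big_split /= addrC lerD2l exchange_big ler_sum.
Qed.

Hypothesis capacity_ge0 : forall j, 0 <= capacity D j.
Hypothesis demand_ge0 : forall i, 0 <= demand D i.

Lemma effective_capacity_ge0 j : 0 <= k j.
Proof. by rewrite !mulr_ge0// subr_ge0 lern1 leq_b1. Qed.

Let total_demand_ge0 : 0 <= total_demand.
Proof. exact: sumr_ge0. Qed.

Let total_capacity_ge0 : 0 <= total_capacity.
Proof. by apply: sumr_ge0 => j _; exact: effective_capacity_ge0. Qed.

Let max_ge0 : 0 <= Num.max total_demand total_capacity.
Proof. by rewrite le_max total_demand_ge0. Qed.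

(* When the maximum is 0, both quotients are 0 / 0 = 0. *)
Let ratio_le1 a : 0 <= a -> a <= Num.max total_demand total_capacity ->
  a / Num.max total_demand total_capacity <= 1.
Proof.
move=> a_ge0; have := max_ge0.
rewrite le_eqVlt => /predU1P[<- _|m_gt0 le_am]; first by rewrite invr0 mulr0.
by rewrite ler_pdivrMr// mul1r.
Qed.

Lemma proportional_alloc_row i :
  \sum_j proportional_alloc i j =
  demand D i * (total_capacity / Num.max total_demand total_capacity).
Proof. by rewrite -mulr_suml -mulr_sumr mulrA. Qed.

Lemma proportional_alloc_col j :
  \sum_i proportional_alloc i j =
  k j * (total_demand / Num.max total_demand total_capacity).
Proof. by rewrite -!mulr_suml mulrAC mulrC. Qed.

(** Rows sum to d_i and columns to k_j, each times a ratio at most 1 because the larger total is the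
    denominator; u is the slack of the demand constraints. *)
Lemma X_proportional_plan : X D y s proportional_plan.
Proof.
split=> /= [i j|i|j|i].
- by rewrite divr_ge0// mulr_ge0// effective_capacity_ge0.
- rewrite proportional_alloc_row subr_ge0 ler_piMr// ratio_le1//.
  by rewrite le_max lexx orbT.
- rewrite proportional_alloc_col ler_piMr ?effective_capacity_ge0//.
  by rewrite ratio_le1// le_max lexx.
- by rewrite addrC subrK.
Qed.

Lemma unmet_proportional_plan :
  unmet proportional_plan = Num.max 0 (total_demand - total_capacity).
Proof.
rewrite /unmet /= sumrB; under [X in _ - X]eq_bigr do
  rewrite proportional_alloc_row.
rewrite -mulr_suml -/total_demand.
have [le_CD|lt_DC] := leP total_capacity total_demand; last first.
  (* Here the denominator is the total capacity, positive because it strictly exceeds a nonnegative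
     demand, so everything is served. *)
  rewrite max_l ?subr_le0 1?ltW// divff ?mulr1 ?subrr//.
  by rewrite gt_eqF// (le_lt_trans total_demand_ge0).
rewrite max_r ?subr_ge0//; have := total_demand_ge0.
(* The denominator is now the total demand, which cancels only if positive. If it is 0, the capacity
   lies between 0 and 0, so both sides vanish. *)
rewrite le_eqVlt => /predU1P[D0|D_gt0]; last by rewrite mulrC divfK ?gt_eqF.
by rewrite -D0 mul0r (le_anti (_ : 0 <= total_capacity <= 0)) //
  total_capacity_ge0 D0.
Qed.

Lemma phi_nonempty : (phi D y s !=set0)%classic.
Proof.
exists proportional_plan; split=> [|xu Xxu]; first exact: X_proportional_plan.
by rewrite unmet_proportional_plan ge_max unmet_ge0// unmet_ge_shortage.
Qed.

End Allocation.

(** An empty recourse set has infimum [+oo], so the comparison also covers infeasible first-stage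
    decisions. *)
Lemma le_opt_value (R : realType) (N F : finType) (D : flp_data R N F)
  (P Q : two_stage R N F) :
  relaxation_of P Q -> (opt_value D P <= opt_value D Q)%E.
Proof.
case=> eq_first eq_unc sub; rewrite /opt_value eq_first eq_unc.
apply: le_bigmin2 => y Qy; apply: leeD2l; apply: le_bigmax2 => s Qs.
by apply/ereal_inf_le_tmp/image_subset/sub.
Qed.

Theorem proposition1 (R : realType) (N F : finType) (D : flp_data R N F)
  (hN : (0 < #|N|)%N) (hF : (0 < #|F|)%N)
  (hf : forall j, 0 <= fixed_cost D j)
  (hK : forall j, 0 <= capacity D j)
  (hd : forall i, 0 <= demand D i)
  (hrho : forall i, 0 <= penalty D i)
  (hc : forall i j, 0 <= alloc_cost D i j) :
  (forall y, feasible (RO_FLP D) y -> feasible (RBO_FLP D) y) /\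
  (relaxation_of (RO_FLP D) (RBO_FLP D) /\
   (opt_value D (RO_FLP D) <= opt_value D (RBO_FLP D))%E).
Proof.
have relax : relaxation_of (RO_FLP D) (RBO_FLP D).
  (* Membership in an argmin over X(y,s) includes membership in X(y,s). *)
  by split=> // y s _ _ xu [].
split; last by split; last exact: le_opt_value.
by move=> y [Ry _]; split=> // s _; exact: phi_nonempty.
Qed.
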